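(* Let $q\in\{1,2,3\}$ and let $(G_k)_{k\ge0}$ be defined by $G_0=\dots=G_{q-2}=0$, $G_{q-1}=1$, $G_{k+q}=G_{k+q-1}+G_k$ ($k\ge0$). In the game described below, starting from a heap of $n\ge1$ beans, the first player has a winning strategy if and only if $n$ is not a $G$ number (i.e., $n\ne G_k$ for all $k$); moreover, when $n$ is not a $G$ number, the first player wins by removing, every time it is his turn to play, a number of beans equal to the least $G$-summand of the number of beans left in the heap.
   Context: Every integer $m\ge1$ has a unique representation $m=\sum_{i\ge0}\epsilon_i G_{2q-2+i}$ with $\epsilon_i\in\{0,1\}$ and $\epsilon_i+\dots+\epsilon_{i+q-1}\le1$ for all $i$; the $G$-summands of $m$ are the terms $G_{2q-2+i}$ with $\epsilon_i=1$, and the least $G$-summand is the smallest of them. The game: a single heap of beans; two players alternately remove a positive number of beans; on the first move any number may be removed except the whole heap; if a player has just removed $p$ beans, the next player may remove $p'$ beans with $p'\le qp$ if $p=1$ or if $q\in\{1,2\}$, and $p'\le qp-1$ if $p\ge2$ and $q=3$. The player removing the last bean wins (a player unable to move loses). *)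

(* Defs.v *)
From mathcomp Require Import all_boot.
From mathcomp Require Import boolp classical_sets.

Set Implicit Arguments.
Unset Strict Implicit.
Unset Printing Implicit Defensive.

(* The list G_k, ..., G_(k+q-1) of q consecutive terms. *)
Definition G_window (q k : nat) : seq nat :=
  iter k (fun s => rcons (behead s) (last 0 s + head 0 s))
    (rcons (nseq q.-1 0) 1).

Definition G (q k : nat) : nat := head 0 (G_window q k).

Lemma size_G_window q k : 0 < q -> size (G_window q k) = q.
Proof.
move=> q0; elim: k => [|k IH]; first by rewrite /= size_rcons size_nseq prednK.
by rewrite /G_window iterS size_rcons size_behead -/(G_window q k) IH prednK.
Qed.

Lemma nth_G_window q k i : i < q -> nth 0 (G_window q k) i = G q (k + i).
Proof.
elim: i k => [|i IH] k iq; first by rewrite addn0 nth0.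
rewrite -addSnnS -(IH k.+1 (ltnW iq)) /G_window iterS -/(G_window q k).
have q0 : 0 < q by apply: leq_trans iq.
rewrite nth_rcons size_behead size_G_window // nth_behead.
by case: q iq {IH q0} => //= q; rewrite ltnS => ->.
Qed.

Lemma G_init0 q k : k < q.-1 -> G q k = 0.
Proof.
move=> kq; have kq' : k < q by apply: leq_trans kq (leq_pred q).
by rewrite -[k]add0n -nth_G_window //= nth_rcons size_nseq kq nth_nseq kq.
Qed.

Lemma G_init1 q : 0 < q -> G q q.-1 = 1.
Proof.
move=> q0; rewrite -[q.-1]add0n -nth_G_window ?prednK //=.
by rewrite nth_rcons size_nseq ltnn eqxx.
Qed.

Lemma G_rec q k : 0 < q -> G q (k + q) = G q (k + q.-1) + G q k.
Proof.
move=> q0; rewrite -(@nth_G_window q k q.-1) ?prednK //.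
have -> : k + q = k.+1 + q.-1 by rewrite addSnnS prednK.
rewrite -nth_G_window ?prednK //.
rewrite /G_window iterS -/(G_window q k) nth_rcons size_behead.
rewrite size_G_window // ltnn eqxx.
by have := nth_last 0 (G_window q k); rewrite size_G_window // => ->.
Qed.

(* eps is the digit sequence of the G-representation of m; the infinite sum
   is read as a finite one, eps having finite support. *)
Definition G_representation (q m : nat) (eps : nat -> bool) : Prop :=
  (forall i, \sum_(i <= j < i + q) eps j <= 1) /\
  (exists2 N, forall i, N <= i -> eps i = false
    & m = \sum_(i < N) eps i * G q (2 * q - 2 + i)).

Definition is_least_G_summand (q m g : nat) : Prop :=
  exists2 eps, G_representation q m eps &
  (exists2 i, eps i & g = G q (2 * q - 2 + i)) /\
  (forall j, eps j -> g <= G q (2 * q - 2 + j)).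

(* The default 0 is never a legal move. *)
Definition least_G_summand (q m : nat) : nat :=
  xget 0 [set g | is_least_G_summand q m g].

(* Largest number of beans that may be removed just after p beans were. *)
Definition cap (q p : nat) : nat :=
  if (p == 1) || (q \in [:: 1; 2]) then q * p else q * p - 1.

(* A history h lists the numbers of beans removed so far, oldest first, from
   a heap of n beans; the first player is to move iff size h is even. *)
Definition beans_left (n : nat) (h : seq nat) : nat := n - sumn h.

Definition legal_move (q n : nat) (h : seq nat) (r : nat) : bool :=
  (0 < r <= beans_left n h) &&
  (if h is [::] then r < n else r <= cap q (last 0 h)).

Definition legal_history (q n : nat) (h : seq nat) : Prop :=
  forall i, i < size h -> legal_move q n (take i h) (nth 0 h i).

Definition game_over (q n : nat) (h : seq nat) : Prop :=
  forall r, ~~ legal_move q n h r.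

Definition first_player_follows (s : seq nat -> nat) (h : seq nat) : Prop :=
  forall i, i < size h -> ~~ odd i -> nth 0 h i = s (take i h).

(* The strategy s always prescribes a legal move when one exists, and every
   finished game played with it ends with the second player unable to move.
   Games always terminate, since each move removes at least one bean. *)
Definition first_player_wins_with (q n : nat) (s : seq nat -> nat) : Prop :=
  (forall h, legal_history q n h -> first_player_follows s h ->
     ~~ odd (size h) -> ~ game_over q n h -> legal_move q n h (s h)) /\
  (forall h, legal_history q n h -> first_player_follows s h ->
     game_over q n h -> odd (size h)).

Definition is_G_number (q n : nat) : Prop := exists k, n = G q k.

(* Main.v *)
(* Write u_i = G_(2q-2+i), and let Z(m) be the least summand of m.  With a
   limit of L beans, the player facing m > 0 beans wins iff Z(m) <= L.  Since
   cap(u_i) < u_(i+q), taking Z(m) leaves the opponent a limit below the next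
   summand.  Conversely, since u_(i+q-1) <= cap(u_i), whoever takes p < Z(m)
   leaves a least summand at most cap(p), by uniqueness of representations. *)
Require Import Defs.
From mathcomp Require Import all_boot.
From mathcomp Require Import zify.
From mathcomp Require Import boolp classical_sets.

Set Implicit Arguments.
Unset Strict Implicit.
Unset Printing Implicit Defensive.

(** * The strictly increasing sequence of summands *)

(** For [0 < q], index [2 * q - 2] is the last at which [G q] equals 1, so the repeated ones are
    skipped. *)
Definition Gs (q i : nat) : nat := G q (2 * q - 2 + i).

Lemma G_ones q j : j < q -> G q (q.-1 + j) = 1.
Proof.
case: q => // q; elim: j => [|j IH] jq; first by rewrite addn0 G_init1.
rewrite -pred_Sn -addSnnS addnC G_rec // (@G_init0 _ j) // addn0.
by rewrite addnC IH // ltnW.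
Qed.

Lemma Gs_init q i : i < q -> Gs q i = i.+1.
Proof.
case: q => // q; elim: i => [|i IH] iq.
  by apply: etrans (@G_ones q.+1 q _) => //; congr G; lia.
have -> : Gs q.+1 i.+1 = G q.+1 ((q + i) + q.+1) by congr G; lia.
rewrite G_rec // (@G_ones q.+1 i) ?(ltnW iq) // addn1 -IH ?(ltnW iq) //.
by congr (G _ _).+1; lia.
Qed.

Lemma Gs_rec q i : 0 < q -> Gs q (i + q) = Gs q (i + q.-1) + Gs q i.
Proof. by move=> q0; rewrite /Gs addnA G_rec // -addnA. Qed.

Lemma Gs_gt0 q i : 0 < q -> 0 < Gs q i.
Proof.
move=> q0; elim/ltn_ind: i => i IH; have [/Gs_init-> //|qi] := ltnP i q.
by rewrite -(subnK qi) Gs_rec // ltn_addl // IH //; lia.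
Qed.

Lemma Gs_ltS q i : 0 < q -> Gs q i < Gs q i.+1.
Proof.
move=> q0; have [iq|qi] := ltnP i.+1 q; first by rewrite !Gs_init // ltnW.
have := Gs_rec (i.+1 - q) q0; rewrite subnK // => ->.
have -> : i.+1 - q + q.-1 = i by lia.
by rewrite -[ltnLHS]addn0 ltn_add2l Gs_gt0.
Qed.

Lemma Gs_lt q i j : 0 < q -> (Gs q i < Gs q j) = (i < j).
Proof.
move=> q0; apply: (leqW_mono (leq_mono (homo_ltn ltn_trans _))).
by move=> k; exact: Gs_ltS.
Qed.

Lemma Gs_le q i j : 0 < q -> (Gs q i <= Gs q j) = (i <= j).
Proof. by move=> q0; rewrite leqNgt Gs_lt // -leqNgt. Qed.

Lemma is_G_numberP q n : 0 < q -> 0 < n ->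
  is_G_number q n <-> exists i, n = Gs q i.
Proof.
move=> q0 n0; split=> [[k nE]|[i ->]]; last by exists (2 * q - 2 + i).
have [kq|qk] := ltnP k q.-1; first by rewrite nE G_init0 in n0.
have [k2|k2] := ltnP k (2 * q - 2).
  exists 0; rewrite nE Gs_init // -(subnKC qk) G_ones //; lia.
by exists (k - (2 * q - 2)); rewrite /Gs subnKC.
Qed.

(** * Existence and uniqueness of representations *)

(* Representations are encoded as increasing lists of indices, successive ones
   at least [q] apart. *)
Definition gap (q a b : nat) : bool := a + q <= b.

Definition Gval (q : nat) (s : seq nat) : nat := \sum_(i <- s) Gs q i.

Lemma Gval_rcons q s k : Gval q (rcons s k) = Gval q s + Gs q k.
Proof. by rewrite /Gval -cats1 big_cat big_seq1. Qed.

Lemma gap_trans q : transitive (gap q).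
Proof. rewrite /gap => b a c; lia. Qed.

Lemma sorted_rcons T (r : rel T) x s y :
  sorted r (rcons (rcons s x) y) = sorted r (rcons s x) && r x y.
Proof. by case: s => [|z s] /=; rewrite ?andbT // !rcons_path last_rcons. Qed.

(** The indices before [k], if any, are at most [k - q]; by induction they contribute less than
    [Gs q (k.+1 - q)], which is the difference of [Gs q k.+1] and [Gs q k]. *)
Lemma Gval_lt q s k : 0 < q -> sorted (gap q) (rcons s k) ->
  Gval q (rcons s k) < Gs q k.+1.
Proof.
move=> q0; elim/last_ind: s k => [|s l IH] k.
  by rewrite /Gval big_seq1 Gs_ltS.
rewrite sorted_rcons => /andP[/IH lt_s]; rewrite /gap => lk.
rewrite Gval_rcons.
have := Gs_rec (k.+1 - q) q0; rewrite subnK; last by lia.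
have -> : k.+1 - q + q.-1 = k by lia.
move=> ->; rewrite addnC ltn_add2l; apply: leq_trans lt_s _.
by rewrite Gs_le //; lia.
Qed.

Lemma Gval_ge q s k : Gs q k <= Gval q (rcons s k).
Proof. by rewrite Gval_rcons leq_addl. Qed.

(** The value [v] determines the last index [k] through [Gs q k <= v < Gs q k.+1]; strip it and
    induct. *)
Lemma Gval_inj q s t : 0 < q -> sorted (gap q) s -> sorted (gap q) t ->
  Gval q s = Gval q t -> s = t.
Proof.
move=> q0; elim/last_ind: s t => [|s k IH] t; case/lastP: t => [//|t l].
- move=> _ _ E; have := Gval_ge q t l; rewrite -E /Gval big_nil.
  by rewrite leqNgt Gs_gt0.
- move=> _ _ E; have := Gval_ge q s k; rewrite E /Gval big_nil.
  by rewrite leqNgt Gs_gt0.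
move=> ss st E.
have kl : k = l.
  apply/eqP; rewrite eqn_leq -(ltnS k) -(ltnS l).
  rewrite -(Gs_lt k _ q0) -(Gs_lt l _ q0); apply/andP; split.
    by apply: leq_ltn_trans (Gval_ge q s k) _; rewrite E Gval_lt.
  by apply: leq_ltn_trans (Gval_ge q t l) _; rewrite -E Gval_lt.
move: ss st E; rewrite -kl => ss st; rewrite !Gval_rcons => /addIn E.
have subs r x : sorted (gap q) (rcons r x) -> sorted (gap q) r.
  by case/lastP: r => // r y; rewrite sorted_rcons => /andP[].
by congr rcons; apply: IH (subs _ _ ss) (subs _ _ st) E.
Qed.

(** Greedy choice: take the largest [Gs q k] not exceeding [m], then represent the remainder. *)
Lemma Gval_surj q m : 0 < q -> exists2 s, sorted (gap q) s & Gval q s = m.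
Proof.
move=> q0; elim/ltn_ind: m => m IH.
have [->|m0] := posnP m; first by exists [::]; rewrite // /Gval big_nil.
have exk : exists k, Gs q k <= m by exists 0; rewrite Gs_init.
have bdk k : Gs q k <= m -> k <= m.
  apply: leq_trans; elim: k => // k /leq_ltn_trans; apply; exact: Gs_ltS.
case: (ex_maxnP exk bdk) => k km kmax.
have mk : m < Gs q k.+1 by rewrite ltnNge; apply/negP => /kmax; rewrite ltnn.
have [|s ss sE] := IH (m - Gs q k); first by have := Gs_gt0 k q0; lia.
exists (rcons s k); last by rewrite Gval_rcons sE subnK.
case/lastP: s ss sE => // s l ss sE; rewrite sorted_rcons ss /gap /=.
(* If [k.+1 < q], the terms are consecutive integers and the remainder is 0, so it has no summand.
   Otherwise the remainder is below [Gs q (k.+1 - q)], which forces the gap. *)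
have := Gval_ge q s l; rewrite sE => lm; have [kq|qk] := ltnP k.+1 q.
  by have := Gs_init kq; have := Gs_init (ltnW kq); have := Gs_gt0 l q0; lia.
have := Gs_rec (k.+1 - q) q0; rewrite subnK //.
have -> : k.+1 - q + q.-1 = k by lia.
move=> E; have : Gs q l < Gs q (k.+1 - q) by lia.
by rewrite Gs_lt //; lia.
Qed.

(** * Digit sequences and index lists *)

Lemma windowP q (eps : nat -> bool) :
  (forall i, \sum_(i <= j < i + q) eps j <= 1) <->
  (forall a b, a < b -> eps a -> eps b -> gap q a b).
Proof.
split=> H.
  move=> a b ab ea eb; rewrite /gap leqNgt; apply/negP => baq.
  have := H a; rewrite big_ltn ?ea; last by lia.
  rewrite (bigD1_seq b) ?iota_uniq //= ?eb //.
  by rewrite mem_index_iota ab.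
(* The sum counts the indices chosen in the window; two of them would be less than [q] apart. *)
move=> i; rewrite -big_mkcond sum1_count -size_filter.
have : sorted ltn [seq j <- index_iota i (i + q) | eps j].
  by apply: sorted_filter; [exact: ltn_trans | exact: iota_ltn_sorted].
have : all (fun j => eps j && (i <= j < i + q))
         [seq j <- index_iota i (i + q) | eps j].
  by apply/allP => j; rewrite mem_filter mem_index_iota.
case: [seq _ <- _ | _] => [|a [|b s]] //= /and3P[/andP[ea ha] /andP[eb hb] _].
by case/andP => ab _; have := H a b ab ea eb; rewrite /gap; lia.
Qed.

Lemma G_representation_seq q m eps : G_representation q m eps ->
  exists s, [/\ sorted (gap q) s, s =i eps & Gval q s = m].
Proof.
case=> /windowP W [N epsN mE]; exists [seq i <- iota 0 N | eps i]; split.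
- apply: pairwise_sorted; apply: (@sub_in_pairwise _ eps ltn).
  + by move=> a b ea eb ab; exact: W.
  + exact: filter_all.
  rewrite -sorted_pairwise; last exact: ltn_trans.
  by apply: sorted_filter; [exact: ltn_trans | exact: iota_ltn_sorted].
- move=> i; rewrite mem_filter mem_iota add0n -[RHS]/(eps i).
  by have [_|/epsN->] := ltnP i N; rewrite ?andbT.
rewrite /Gval big_filter big_mkcond -{1}(subn0 N) -/(index_iota 0 N) big_mkord mE.
by apply: eq_bigr => i _; case: (eps i); rewrite ?mul1n.
Qed.

Lemma seq_G_representation q s : 0 < q -> sorted (gap q) s ->
  G_representation q (Gval q s) (fun i => i \in s).
Proof.
move=> q0 ss; have ltns : sorted ltn s.
  by apply: sub_sorted ss => a b; rewrite /gap; lia.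
split.
  apply/windowP => a b ab sa sb.
  have := sorted_ltn_nth ltn_trans 0 ltns; have := sorted_ltn_nth (@gap_trans q) 0 ss.
  move=> /(_ (index a s) (index b s)); rewrite !inE !index_mem !nth_index //.
  move=> Hg /(_ (index b s) (index a s)); rewrite !inE !index_mem !nth_index //.
  move=> Hl; case: (ltngtP (index a s) (index b s)) => [/Hg|/Hl|]; first exact.
    by move=> /(_ sb sa); lia.
  by move=> E; move: ab; rewrite -(nth_index 0 sa) E nth_index // ltnn.
have leqs i : i \in s -> i < (\max_(j <- s) j).+1.
  by move=> si; rewrite ltnS; apply: leq_bigmax_seq.
exists (\max_(j <- s) j).+1.
  by move=> i; apply: contraTF => /leqs; rewrite -ltnNge.
set N := _.+1.
have {1}-> : s = [seq i <- iota 0 N | i \in s].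
  apply: (irr_sorted_eq ltn_trans ltnn ltns).
    by apply: sorted_filter; [exact: ltn_trans | exact: iota_ltn_sorted].
  move=> i; rewrite mem_filter mem_iota add0n /=.
  by case si: (i \in s) => //=; rewrite leqs.
rewrite /Gval big_filter big_mkcond -{1}(subn0 N) -/(index_iota 0 N) big_mkord.
by apply: eq_bigr => i _; case: (_ \in s); rewrite ?mul1n.
Qed.

(** * The least summand *)

(** [xget] has only one candidate: by [Gval_inj], every digit sequence of this number has index list
    [i :: s]. *)
Lemma least_G_summandE q i s : 0 < q -> path (gap q) i s ->
  least_G_summand q (Gval q (i :: s)) = Gs q i.
Proof.
move=> q0 ss; have lei j : j \in i :: s -> i <= j.
  rewrite inE => /orP[/eqP-> //|js].
  have /allP/(_ j js) := order_path_min (@gap_trans q) ss.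
  by rewrite /gap; lia.
rewrite /least_G_summand; apply: xget_unique => /=.
  exists (fun j => j \in i :: s); first exact: seq_G_representation.
  split; first by exists i; rewrite ?mem_head.
  by move=> j /lei; rewrite -/(Gs q i) -/(Gs q j) Gs_le.
move=> g [eps /G_representation_seq[t [st tE valE]] [[k ek ->] kmin]].
have ts : t = i :: s by apply: Gval_inj valE.
have ki : k <= i.
  by rewrite -(Gs_le _ _ q0); apply: kmin; rewrite -[eps i]tE ts mem_head.
congr G; congr addn; apply/eqP; rewrite eqn_leq ki lei //.
by rewrite -ts tE.
Qed.

Lemma least_G_summandP q m : 0 < q -> 0 < m ->
  exists i s, [/\ path (gap q) i s, Gval q (i :: s) = m
                & least_G_summand q m = Gs q i].
Proof.
move=> q0 m0; have [[|i s] ss sE] := Gval_surj m q0.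
  by move: m0; rewrite -sE /Gval big_nil.
by exists i, s; split=> //; rewrite -sE least_G_summandE.
Qed.

Lemma least_G_summand_bounds q m : 0 < q -> 0 < m ->
  0 < least_G_summand q m <= m.
Proof.
move=> q0 /(least_G_summandP q0)[i [s [_ <- ->]]].
by rewrite Gs_gt0 // /Gval big_cons leq_addr.
Qed.

(** * Estimates for the removal limit *)

Lemma cap_gt0 q p : q \in [:: 1; 2; 3] -> 0 < p -> 0 < cap q p.
Proof.
rewrite /cap !inE => /or3P[]/eqP-> /=; rewrite ?orbT ?orbF; try lia.
by case: eqP; lia.
Qed.

Lemma cap_mono q p r : q \in [:: 1; 2; 3] -> 0 < p <= r -> cap q p <= cap q r.
Proof.
rewrite /cap !inE => /or3P[]/eqP-> /=; rewrite ?orbT ?orbF; try lia.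
by do 2 case: eqP; lia.
Qed.

Lemma cap_Gs_lt q i : q \in [:: 1; 2; 3] -> cap q (Gs q i) < Gs q (i + q).
Proof.
rewrite /cap !inE => /or3P[]/eqP-> /=; rewrite ?orbT ?orbF.
- by rewrite Gs_rec // addn0; have := @Gs_gt0 1 i isT; lia.
- by rewrite Gs_rec // addn1; have := @Gs_ltS 2 i isT; lia.
(* Three initial cases, then the recurrence adds two earlier inequalities. Equality occurs at
   indices 1 and 2, where the [- 1] in [cap] gives strictness. *)
have : 3 * Gs 3 i <= Gs 3 (i + 3).
  elim/ltn_ind: i => -[|[|[|i]]] IH; first 3 last.
  - have := Gs_rec i.+3 (isT : 0 < 3); have := Gs_rec i (isT : 0 < 3).
    have := IH i.+2 (ltnSn _).
    have : 3 * Gs 3 i <= Gs 3 (i + 3) by apply: IH; lia.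
    by rewrite /= !addnS !addn0; lia.
  - by rewrite Gs_rec // !Gs_init.
  - by rewrite Gs_rec // (@Gs_rec 3 0) // !Gs_init.
  by rewrite Gs_rec // (@Gs_rec 3 1) // (@Gs_rec 3 0) // !Gs_init.
case: eqP => [|_]; last by have := @Gs_gt0 3 i isT; lia.
case: i => [|i]; first by rewrite Gs_rec // !Gs_init.
have := @Gs_lt 3 0 i.+1 isT; rewrite (@Gs_init 3 0) //; lia.
Qed.

Lemma cap_Gs_ge q i : q \in [:: 1; 2; 3] -> Gs q (i + q.-1) <= cap q (Gs q i).
Proof.
rewrite /cap !inE => /or3P[]/eqP-> /=; rewrite ?orbT ?orbF.
- by rewrite addn0; lia.
- rewrite addn1; case: i => [|i]; first by rewrite !Gs_init.
  have := @Gs_rec 2 i isT; have := @Gs_ltS 2 i isT.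
  by rewrite !addnS !addn0; lia.
case: i => [|[|[|i]]]; first by rewrite !Gs_init.
- by rewrite (@Gs_rec 3 0) // !Gs_init.
- by rewrite (@Gs_rec 3 1) // (@Gs_rec 3 0) // !Gs_init.
have := @Gs_rec 3 i.+2 isT; have := @Gs_rec 3 i.+1 isT.
have := @Gs_ltS 3 i.+1 isT; have := @Gs_ltS 3 i.+2 isT.
have := @Gs_gt0 3 i.+1 isT; rewrite /= !addnS !addn0; case: eqP; lia.
Qed.

(** * Winning and losing positions *)

(* [m] beans are left and at most [L] may be removed; [cold] includes [m = 0]. *)
Definition hot (q m L : nat) : Prop := 0 < m /\ least_G_summand q m <= L.

Definition cold (q m L : nat) : Prop := 0 < m -> L < least_G_summand q m.

Lemma hot_to_cold q m : q \in [:: 1; 2; 3] -> 0 < m ->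
  cold q (m - least_G_summand q m) (cap q (least_G_summand q m)).
Proof.
move=> hq m0; have q0 : 0 < q by move: hq; rewrite !inE; lia.
have [i [[|j s] [ss <- ->]]] := least_G_summandP q0 m0.
  by rewrite /cold /Gval big_seq1 subnn.
rewrite /Gval big_cons addKn => _; move: ss => /= /andP[ij ss].
rewrite least_G_summandE //; apply: leq_trans (cap_Gs_lt i hq) _.
by rewrite Gs_le.
Qed.

(* If the least summand of [u_j - p] exceeded [cap p], the representations of
   [p] and [u_j - p] could be concatenated into a second one of [u_j]. *)
Lemma cold_to_hot q m L p : q \in [:: 1; 2; 3] -> cold q m L ->
  0 < p <= m -> p <= L -> hot q (m - p) (cap q p).
Proof.
move=> hq cm /andP[p0 pm] pL; have q0 : 0 < q by move: hq; rewrite !inE; lia.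
have m0 : 0 < m by apply: leq_trans pm.
have := leq_ltn_trans pL (cm m0).
have [j [t [st mE ->]]] := least_G_summandP q0 m0 => pj.
have [x0 [i [s [ss sE _]]]] : 0 < Gs q j - p /\ exists i s, [/\ path (gap q) i s,
    Gval q (i :: s) = Gs q j - p
    & least_G_summand q (Gs q j - p) = Gs q i].
  by split; [|apply: least_G_summandP => //]; lia.
(* Since [Gs q j - p] is less than [Gs q j], its indices stay below [j], so its list can precede
   [t]. *)
have lastj : last i s < j.
  rewrite -(Gs_lt _ _ q0); apply: (@leq_ltn_trans (Gs q j - p)); last by lia.
  by rewrite -sE lastI Gval_ge.
have sst : path (gap q) i (s ++ t).
  rewrite cat_path ss /=; case: t st {mE} => //= k t /andP[jk ->].
  by rewrite andbT; move: jk; rewrite /gap; lia.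
have mpE : m - p = Gval q (i :: (s ++ t)).
  rewrite -cat_cons /Gval big_cat /= -/(Gval q _) -/(Gval q _) sE.
  by rewrite -mE /Gval big_cons; lia.
split; first by rewrite mpE /Gval big_cons ltn_addr // Gs_gt0.
rewrite mpE least_G_summandE // leqNgt; apply/negP => capi.
have [r sr rE] := Gval_surj p q0.
case/lastP: r sr rE => [|r k] sr rE; first by move: p0; rewrite -rE /Gval big_nil.
have kp : Gs q k <= p by rewrite -rE Gval_ge.
(* Otherwise [i <= k + q.-1], and [Gs q i <= cap q (Gs q k) <= cap q p] contradicts [capi]. *)
have ki : gap q k i.
  rewrite /gap leqNgt; apply/negP => ik; move: capi; rewrite ltnNge => /negP[].
  apply: leq_trans (cap_mono hq (_ : 0 < Gs q k <= p)); last first.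
    by rewrite Gs_gt0.
  by apply: leq_trans (cap_Gs_ge k hq); rewrite Gs_le //; lia.
(* Both lists represent [Gs q j], yet the left one has at least two entries. *)
have : rcons r k ++ i :: s = [:: j].
  apply: (Gval_inj q0) => //; last first.
    rewrite /Gval big_cat big_seq1 -/(Gval q _) -/(Gval q _) /= rE sE; lia.
  by case: r sr {rE} => [|a r] /= sr; rewrite ?ki // cat_path sr last_rcons /= ki.
by move/(congr1 size); rewrite size_cat size_rcons /=; lia.
Qed.

(** * Histories and strategies *)

(** [n.-1] encodes the ban on taking the whole heap at the first move. *)
Definition limit (q n : nat) (h : seq nat) : nat :=
  if h is [::] then n.-1 else cap q (last 0 h).

Lemma legal_moveE q n h r : 0 < n ->
  legal_move q n h r = (0 < r <= beans_left n h) && (r <= limit q n h).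
Proof. by move=> n0; rewrite /legal_move; case: h => //=; case: n n0. Qed.

Lemma limit_rcons q n h r : limit q n (rcons h r) = cap q r.
Proof. by rewrite /limit last_rcons; case: h. Qed.

Lemma beans_left_rcons n h r : beans_left n (rcons h r) = beans_left n h - r.
Proof. by rewrite /beans_left sumn_rcons subnDA. Qed.

(** Common form of [legal_history] and [first_player_follows], for induction on the last move. *)
Lemma forall_lt_rcons (P : seq nat -> nat -> Prop) h r :
  (forall i, i < size (rcons h r) -> P (take i (rcons h r)) (nth 0 (rcons h r) i))
  <-> (forall i, i < size h -> P (take i h) (nth 0 h i)) /\ P h r.
Proof.
rewrite size_rcons; split=> [H|[H Hr] i].
  split=> [i ih|].
    have := H i; rewrite nth_rcons ih -cats1 take_cat ih; apply.
    exact: ltnW.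
  by have := H (size h); rewrite nth_rcons ltnn eqxx -cats1 take_size_cat //; apply.
rewrite ltnS leq_eqVlt => /orP[/eqP->|ih].
  by rewrite nth_rcons ltnn eqxx -cats1 take_size_cat.
by rewrite nth_rcons ih -cats1 take_cat ih; apply: H.
Qed.

Lemma legal_history_rcons q n h r :
  legal_history q n (rcons h r) <-> legal_history q n h /\ legal_move q n h r.
Proof. exact: (forall_lt_rcons (fun h r => legal_move q n h r)). Qed.

Lemma first_player_follows_rcons s h r :
  first_player_follows s (rcons h r) <->
  first_player_follows s h /\ (~~ odd (size h) -> r = s h).
Proof.
(* Reading the parity of [i] off the prefix gives a predicate of prefix and move alone. *)
have E t : first_player_follows s t <-> forall i, i < size t ->
    ~~ odd (size (take i t)) -> nth 0 t i = s (take i t).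
  split=> H i it; have := H i it; by rewrite size_take it.
rewrite E (E h).
exact: (forall_lt_rcons (fun h r => ~~ odd (size h) -> r = s h)).
Qed.

Lemma hot_legal q n h : 0 < q -> 0 < n ->
  hot q (beans_left n h) (limit q n h) ->
  legal_move q n h (least_G_summand q (beans_left n h)).
Proof.
by move=> q0 n0 [m0 mL]; rewrite legal_moveE // mL andbT least_G_summand_bounds.
Qed.

Lemma least_G_summand_wins q n : q \in [:: 1; 2; 3] -> 0 < n ->
  hot q n n.-1 ->
  first_player_wins_with q n (fun h => least_G_summand q (beans_left n h)).
Proof.
move=> hq n0 hotn; have q0 : 0 < q by move: hq; rewrite !inE; lia.
set s := fun h => _.
(* The first player always faces a hot position, where a legal move exists, so play can only stop on
   the second player's turn. *)
have inv h : legal_history q n h -> first_player_follows s h ->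
    if odd (size h) then cold q (beans_left n h) (limit q n h)
    else hot q (beans_left n h) (limit q n h).
  elim/last_ind: h => [|h r IH]; first by rewrite /beans_left /= subn0.
  move=> /legal_history_rcons[lh lr] /first_player_follows_rcons[fh fr].
  have {IH} := IH lh fh.
  move: lr; rewrite legal_moveE // size_rcons beans_left_rcons limit_rcons /=.
  case: (odd (size h)) fr => /= [_|-> //] /andP[lr lim].
    by move/cold_to_hot; apply.
  by case=> m0 _; apply: hot_to_cold.
split=> h lh fh.
  by move=> /negPf ev _; have := inv h lh fh; rewrite ev; apply: hot_legal.
move=> over; apply: contraT => /negPf ev; have := inv h lh fh.
by rewrite ev => /(hot_legal q0 n0); rewrite (negPf (over _)).
Qed.

(** Answering each move of [s] with the least summand returns the first player to a cold position
    with a smaller heap, whence the strong induction on the heap. *)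
Lemma cold_no_win q n s : q \in [:: 1; 2; 3] -> 0 < n ->
  cold q n n.-1 -> ~ first_player_wins_with q n s.
Proof.
move=> hq n0 coldn [s_legal s_wins].
have q0 : 0 < q by move: hq; rewrite !inE; lia.
have inv m : forall h, beans_left n h = m -> legal_history q n h ->
    first_player_follows s h -> ~~ odd (size h) ->
    cold q (beans_left n h) (limit q n h) -> False.
  elim/ltn_ind: m => m IH h hm lh fh ev ch.
  have not_over : ~ game_over q n h.
    by move=> over; have := s_wins h lh fh over; rewrite (negPf ev).
  have := s_legal h lh fh ev not_over; set p := s h => lp.
  have := lp; rewrite legal_moveE // => /andP[pm pL].
  have [m0 hot1] := cold_to_hot hq ch pm pL.
  have lr : legal_move q n (rcons h p) (least_G_summand q (beans_left n h - p)).
    by rewrite -beans_left_rcons; apply: hot_legal => //;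
      rewrite beans_left_rcons limit_rcons.
  apply: (IH (beans_left n (rcons (rcons h p)
      (least_G_summand q (beans_left n h - p))))) => //.
  - by rewrite !beans_left_rcons -hm; lia.
  - by apply/legal_history_rcons; split=> //; apply/legal_history_rcons.
  - apply/first_player_follows_rcons; split.
      by apply/first_player_follows_rcons.
    by rewrite size_rcons /= ev.
  - by rewrite !size_rcons /= negbK.
  by rewrite !beans_left_rcons limit_rcons; apply: hot_to_cold.
by apply: (inv n [::]) => //; rewrite /beans_left /= subn0.
Qed.

Theorem theorem5 (q n : nat) (hq : q \in [:: 1; 2; 3]) (hn : 1 <= n) :
  ((exists s : seq nat -> nat, first_player_wins_with q n s) <->
     ~ is_G_number q n) /\
  (~ is_G_number q n ->
     first_player_wins_with q n
       (fun h => least_G_summand q (beans_left n h))).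
Proof.
have q0 : 0 < q by move: hq; rewrite !inE; lia.
have wins : ~ is_G_number q n ->
    first_player_wins_with q n (fun h => least_G_summand q (beans_left n h)).
  rewrite is_G_numberP // => notG; apply: least_G_summand_wins => //; split=> //.
  have := least_G_summand_bounds q0 hn.
  (* The least summand is at most [n], and equality would make [n] a G number. *)
  have [i [_ [_ _ ->]]] := least_G_summandP q0 hn => /andP[_].
  rewrite leq_eqVlt => /orP[/eqP iE|]; last by lia.
  by case: notG; exists i.
split=> //; split=> [[s swins]|notG]; last by eexists; apply: wins.
rewrite is_G_numberP // => -[i nE]; apply: cold_no_win swins => // _.
(* [[:: i]] represents [n], so the least summand is the whole heap, beyond the first limit
   [n.-1]. *)
have -> : least_G_summand q n = n; last by lia.
by rewrite {1}nE; have := @least_G_summandE q i [::] q0 isT; rewrite /Gval big_seq1 -nE.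
Qed.
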